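(* Let $n$ and $\ell$ be even positive integers, and let $k$ be the smallest nonnegative integer such that $\gcd(n-2k-1,\ell)=1$. If $0\le k\le 3$, then \[\max(n,\ell)=\binom{n}{2}-\left(\frac{n}{2}+k\right),\] and the $(n,\ell)$-extremal graphs are precisely the graphs $G$ of order $n$ whose complement $\overline{G}$ is a pendant graph (of order $n$ and size $\frac{n}{2}+k$), i.e. the complements of pendant graphs of order $n$, these complements having size $\binom{n}{2}-\left(\frac{n}{2}+k\right)$.
   Context: All graphs are finite and simple; $\overline{G}$ denotes the complement of $G$. Fix an integer $\ell\ge 2$; vertex labels lie in $\mathbb{Z}_\ell$. In the neighborhood Lights Out game on a graph $G$, one starts with a labeling $V(G)\to\mathbb{Z}_\ell$; toggling a vertex $v$ adds $1$ (mod $\ell$) to the label of every vertex of the closed neighborhood $N[v]$; the game is won when every label is $0$. $G$ is called $N$-AW (always winnable) if the game can be won from every initial labeling (equivalently, the matrix $A(G)+I$ is invertible over $\mathbb{Z}_\ell$). $\max(n,\ell)$ is the maximum number of edges of an $N$-AW graph on $n$ vertices, and an $(n,\ell)$-extremal graph is an $N$-AW graph of order $n$ with exactly $\max(n,\ell)$ edges. For a graph $H$, $H\odot K_1$ is the graph obtained from $H$ by adding, for each vertex $u$ of $H$, a new vertex adjacent only to $u$; a pendant graph is a graph of the form $H\odot K_1$. *)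

(* Defs.v *)
From HB Require Import structures.
From mathcomp Require Import all_boot all_order all_algebra.
From mathcomp Require Import boolp.
Set Implicit Arguments. Unset Strict Implicit. Unset Printing Implicit Defensive.
Import GRing.Theory.

Definition simple_graph (T : finType) (E : {set {set T}}) : bool :=
  [forall e in E, #|e| == 2].

Definition adj (T : finType) (E : {set {set T}}) (u v : T) : bool :=
  [set u; v] \in E.

Definition gcompl (T : finType) (E : {set {set T}}) : {set {set T}} :=
  [set e : {set T} | (#|e| == 2) && (e \notin E)].

Definition closed_nbhd (T : finType) (E : {set {set T}}) (v : T) : {set T} :=
  [set u | (u == v) || adj E v u].

(* Neighborhood Lights Out over Z_l on a graph with vertex set 'I_n:
   starting from labeling lab, toggling each vertex v exactly t v times
   (the order is irrelevant) yields label lab u + #{toggles of v with u in N[v]}.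
   The graph is N-AW if every labeling can be turned into the all-zero one. *)
Definition N_AW (l n : nat) (E : {set {set 'I_n}}) : Prop :=
  forall lab : 'I_n -> 'Z_l, exists t : 'I_n -> nat,
    forall u : 'I_n,
      (lab u + ((\sum_(v < n | u \in closed_nbhd E v) t v)%N)%:R)%R = 0%R :> 'Z_l.

(* max(n,l): maximum number of edges of an N-AW graph of order n
   (the edgeless graph is N-AW, so the maximum is over a nonempty family). *)
Definition maxAW (n l : nat) : nat :=
  \max_(E : {set {set 'I_n}} | simple_graph E && `[< N_AW l E >]) #|E|.

Definition extremal (n l : nat) (E : {set {set 'I_n}}) : Prop :=
  simple_graph E /\ N_AW l E /\ #|E| = maxAW n l.

(* Corona H ⊙ K1 of a graph H on 'I_m: vertex type 'I_m + 'I_m, where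
   inl u is the original vertex u and inr u is its new pendant neighbour. *)
Definition corona (m : nat) (H : {set {set 'I_m}}) : {set {set ('I_m + 'I_m)}} :=
  [set (@inl 'I_m 'I_m) @: (e : {set 'I_m}) | e in H] :|:
  [set [set (@inl 'I_m 'I_m u); (@inr 'I_m 'I_m u)] | u : 'I_m].

Definition graph_iso (T T' : finType) (E : {set {set T}}) (E' : {set {set T'}}) : Prop :=
  exists f : T -> T', bijective f /\
    forall u v : T, adj E u v = adj E' (f u) (f v).

Definition pendant (T : finType) (E : {set {set T}}) : Prop :=
  exists m (H : {set {set 'I_m}}), simple_graph H /\ graph_iso E (corona H).

(* Main.v *)
Require Import Defs.
From mathcomp Require Import all_boot all_order all_algebra.
From mathcomp Require Import zify ring.
From mathcomp Require boolp.

Set Implicit Arguments. Unset Strict Implicit. Unset Printing Implicit Defensive.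
Import GRing.Theory.

(** Let B be the adjacency matrix of the complement F of G, so that
A(G) + I = J - B. Bordering B by a row and a column of ones gives an alternating
matrix of odd order over F_2, which is singular; hence J - B invertible modulo
the even number l forces B to be nonsingular modulo 2.

When F has at most n/2 + 3 edges, this nonsingularity always provides a leaf b,
with neighbour a say, and deleting a and b preserves it. Eliminating leaf by leaf
solves B x = 1 over the integers, with sum x = n - 2j, 0 <= j <= |F| - n/2 and
equality on the right only if F is pendant. Since (J - B) x = (n - 2j - 1) 1,
invertibility of J - B modulo l forces gcd(n - 2j - 1, l) = 1, so k <= j.
Conversely, if F is pendant, B has an explicit inverse, whose entries sum to
n - 2 (|F| - n/2). *)

(** * Leaf elimination in a graph whose adjacency matrix is nonsingular over F_2 *)

Section LeafElimination.

Variables (T : finType) (r : rel T).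
Hypotheses (rsym : symmetric r) (rirr : irreflexive r).
Implicit Types (S Y : {set T}) (a b u v : T) (d : T -> nat) (w x : T -> int).

Definition deg S v : nat := \sum_(u in S) r v u.

Definition degsum S : nat := \sum_(v in S) deg S v.

(** [Y] is the support of a vector over F_2: the adjacency matrix of the subgraph induced on [S] has
    trivial kernel. *)
Definition nonsingular2 S : Prop := forall Y, Y \subset S ->
  (forall v, v \in S -> ~~ odd (deg Y v)) -> Y = set0.

Definition leaf S b a : Prop :=
  [/\ a \in S, b \in S & forall u, u \in S -> r b u = (u == a)].

Definition solves S w x : Prop :=
  forall v, v \in S -> (\sum_(u in S) (r v u)%:R * x u = w v)%R.

(* [R] marks the vertices of the underlying graph [H] of a corona, and [p] swaps
each of them with its pendant neighbour. *)
Definition pendant_on S d : Prop := exists (R : pred T) (p : T -> T),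
  forall v, v \in S ->
    [/\ p v \in S, p (p v) = v, R (p v) = ~~ R v &
      ~~ R v -> d v = 0 /\ forall u, u \in S -> r v u = (u == p v)].

Lemma deg_card S v : deg S v = #|[set u in S | r v u]|.
Proof.
rewrite /deg -sum1_card [RHS]big_mkcond [LHS]big_mkcond.
by apply: eq_bigr => u _; rewrite inE; case: (u \in S); case: (r v u).
Qed.

Lemma leaf_neq S b a : leaf S b a -> a != b.
Proof.
case=> aS bS /(_ a aS); rewrite eqxx => rba.
by apply/eqP => ab; rewrite ab rirr in rba.
Qed.

Lemma leaf_sumE (M : nmodType) S b a (f : T -> M) : leaf S b a ->
  (\sum_(v in S) f v = f a + (f b + \sum_(v in S :\ a :\ b) f v))%R.
Proof.
move=> lf; have ab := leaf_neq lf; case: lf => aS bS _.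
by rewrite (big_setD1 a) //= (big_setD1 b) //= !inE eq_sym ab.
Qed.

Lemma leaf_sumnE S b a (f : T -> nat) : leaf S b a ->
  \sum_(v in S) f v = f a + (f b + \sum_(v in S :\ a :\ b) f v).
Proof. exact: (@leaf_sumE nat). Qed.

Lemma leaf_card S b a : leaf S b a -> #|S| = #|S :\ a :\ b|.+2.
Proof.
by move=> lf; have := leaf_sumnE (fun=> 1) lf; rewrite !sum1_card => ->.
Qed.

Lemma in_delete S a b v :
  v \in S :\ a :\ b -> [/\ v \in S, v != a & v != b].
Proof. by rewrite !inE => /and3P[]. Qed.

Lemma leaf_delete S b a v : leaf S b a -> v \in S :\ a :\ b -> r b v = false.
Proof.
by case=> _ _ lf /in_delete[vS va _]; rewrite lf // (negbTE va).
Qed.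

Lemma leaf_adj S b a : leaf S b a -> r b a.
Proof. by case=> aS _ /(_ a aS) ->. Qed.

Lemma nonsingular2_deg_gt0 S v : nonsingular2 S -> v \in S -> 0 < deg S v.
Proof.
move=> nS vS; rewrite lt0n; apply/eqP => dv.
have /setP/(_ v) : [set v] = set0.
  apply: nS => [|u uS]; first by rewrite sub1set.
  rewrite /deg big_set1 rsym; move/eqP: dv; rewrite /deg sum_nat_eq0.
  by move/forall_inP/(_ _ uS)/eqP ->.
by rewrite !inE eqxx.
Qed.

Lemma nonsingular2_degsum S : nonsingular2 S -> #|S| <= degsum S.
Proof.
move=> nS; rewrite -sum1_card; apply: leq_sum => v.
exact: nonsingular2_deg_gt0.
Qed.

(** A kernel vector [Y] of the smaller graph extends to [S] by adding [b] exactly when [a] has an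
    odd number of neighbours in [Y]. As [b] has no neighbour but [a], only the equation at [a] is
    affected. *)
Lemma nonsingular2_delete S b a :
  leaf S b a -> nonsingular2 S -> nonsingular2 (S :\ a :\ b).
Proof.
move=> lf nS Y YS ev.
have YbN : b \notin Y.
  by apply/negP => /(subsetP YS); rewrite !inE eqxx.
pose Z := if odd (deg Y a) then b |: Y else Y.
have degZ v : deg Z v = (odd (deg Y a) && r v b) + deg Y v.
  by rewrite /Z; case: ifP => _ //=; rewrite /deg big_setU1.
have sub : S :\ a :\ b \subset S by apply/subsetP => v /in_delete[].
have bS : b \in S by case: lf.
have Z0 : Z = set0.
  apply: nS => [|v vS].
    rewrite /Z; case: ifP => _; last exact: subset_trans YS sub.
    by rewrite subUset sub1set bS (subset_trans YS sub).
  rewrite degZ oddD.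
  have [->|va] := eqVneq v a.
    by rewrite (rsym a) (leaf_adj lf) andbT; case: (odd (deg Y a)).
  have [->|vb] := eqVneq v b.
    rewrite rirr andbF /= /deg big1 // => u uY.
    by rewrite (leaf_delete lf) // (subsetP YS).
  have vS' : v \in S :\ a :\ b by rewrite !inE vb va.
  by rewrite rsym (leaf_delete lf) // andbF /= ev.
by move: Z0; rewrite /Z; case: ifP => // _ /setP/(_ b); rewrite !inE eqxx.
Qed.

Lemma deg_leaf S b a : leaf S b a -> deg S b = 1.
Proof.
move=> lf; rewrite /deg (leaf_sumnE _ lf) (leaf_adj lf) rirr big1 // => u uS.
by rewrite (leaf_delete lf).
Qed.

Lemma deg_hub S b a : leaf S b a -> deg S a = (deg (S :\ a :\ b) a).+1.
Proof.
by move=> lf; rewrite {1}/deg (leaf_sumnE _ lf) rirr rsym (leaf_adj lf).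
Qed.

(** The edges lost are those at [a], among them the only edge at [b]; each counts twice. *)
Lemma degsum_delete S b a : leaf S b a ->
  degsum S = degsum (S :\ a :\ b) + 2 * (deg (S :\ a :\ b) a).+1.
Proof.
move=> lf; rewrite {1}/degsum (leaf_sumnE _ lf) (deg_leaf lf) (deg_hub lf).
suff -> : \sum_(v in S :\ a :\ b) deg S v =
    deg (S :\ a :\ b) a + degsum (S :\ a :\ b) by lia.
rewrite /degsum [deg _ a]/deg -big_split /=; apply: eq_bigr => v vS.
rewrite /deg (leaf_sumnE _ lf) (rsym v b) (leaf_delete lf vS) add0n.
by rewrite rsym.
Qed.

Lemma deg1_leaf S v : v \in S -> deg S v = 1 -> exists a, leaf S v a.
Proof.
rewrite deg_card => vS /eqP/cards1P[a /setP Na]; exists a.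
have := Na a; rewrite !inE eqxx => /andP[aS rva]; split=> // u uS.
by have := Na u; rewrite !inE uS.
Qed.

(* Without a leaf the degree bound leaves at most six vertices: either all
degrees are two, and [S] itself is a kernel vector, or [#|S| = 4], and a vertex
of degree two and its unique non-neighbour have the same neighbours. *)
Lemma exists_leaf S : nonsingular2 S -> ~~ odd #|S| -> 0 < #|S| ->
  degsum S <= #|S| + 6 -> exists a b, leaf S b a.
Proof.
move=> nS evS S_gt0 dS.
case: (boolP [exists v in S, deg S v == 1]).
  by case/exists_inP=> v vS /eqP /(deg1_leaf vS)[a lf]; exists a, v.
rewrite negb_exists_in => /forall_inP noleaf; exfalso.
have deg2 v : v \in S -> 2 <= deg S v.
  move=> vS; have := nonsingular2_deg_gt0 nS vS; have := noleaf v vS; lia.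
have deg_lt v : v \in S -> deg S v < #|S|.
  move=> vS; rewrite deg_card; apply: proper_card; rewrite properE.
  apply/andP; split; first by apply/subsetP => u; rewrite inE => /andP[].
  by apply/subsetPn; exists v; rewrite // inE rirr andbF.
have dS2 : #|S| * 2 <= degsum S.
  by rewrite -sum_nat_const; apply: leq_sum => v; apply: deg2.
case: (boolP [forall v in S, deg S v == 2]).
  move=> /forall_inP all2; have S0 : S = set0.
    by apply: nS => // v vS; rewrite (eqP (all2 v vS)).
  by move: S_gt0; rewrite S0 cards0.
rewrite negb_forall_in => /exists_inP[z zS dz].
(* A vertex of degree at least three makes [degsum S] exceed [2 * #|S|], so [#|S| < 6]; it also
   needs three neighbours, so [#|S| > 3]. Parity leaves four. *)
have cS : #|S| = 4.
  have dS3 : #|S| * 2 < degsum S.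
    rewrite /degsum (bigD1 z) //= -sum_nat_const (bigD1 z) //=.
    rewrite -addSn leq_add //; first by have := deg2 z zS; lia.
    by apply: leq_sum => v /andP[vS _]; apply: deg2.
  have := deg_lt z zS; have := deg2 z zS; lia.
have [v vS dv] : exists2 v, v \in S & deg S v = 2.
  case: (boolP [exists v in S, deg S v == 2]).
    by case/exists_inP=> v vS /eqP dv; exists v.
  rewrite negb_exists_in => /forall_inP no2.
  have : #|S| * 3 <= degsum S.
    rewrite -sum_nat_const; apply: leq_sum => v vS.
    by have := deg2 v vS; have := no2 v vS; lia.
  by rewrite cS; lia.
pose A := [set u in S | r v u].
have cA : #|A| = 2 by rewrite -dv deg_card.
have AS : A \subset S :\ v.
  apply/subsetP => u; rewrite !inE => /andP[-> rvu]; rewrite andbT.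
  by apply/eqP => uv; rewrite uv rirr in rvu.
have /eqP/cards1P[u /setP Cu] : #|(S :\ v) :\: A| = 1.
  by rewrite cardsDS // cA; have := cardsD1 v S; rewrite vS cS; lia.
have := Cu u; rewrite !inE eqxx => /and3P[]; rewrite negb_and => ruv uv uS.
have {}ruv : r v u = false by move: ruv; rewrite uS /= => /negbTE.
(* The neighbours of [u] avoid [u] and [v], so they lie in the two-element set [A], and there are at
   least two of them. *)
have NuA : [set t in S | r u t] = A.
  apply/eqP; rewrite eqEcard cA -deg_card deg2 // andbT.
  apply/subsetP => t; rewrite !inE => /andP[tS rut]; rewrite tS /=.
  apply: contraT => rvt; have := Cu t; rewrite !inE tS rvt /=.
  case: eqP rut => [->|_]; first by rewrite rsym ruv.
  by case: eqP => // ->; rewrite rirr.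
have /setP/(_ v) : [set u; v] = set0.
  apply: nS => [|t tS]; first by rewrite subUset !sub1set uS vS.
  rewrite /deg big_setU1 ?inE //= big_set1 oddD.
  have /setP/(_ t) := NuA; rewrite !inE tS /= => rt.
  by rewrite (rsym t u) (rsym t v) rt; case: (r v t).
by rewrite !inE eqxx orbT.
Qed.

Local Open Scope ring_scope.

(** The row of [b] forces [y a = w b]; moving this known term to the right-hand side leaves the
    system on the remaining vertices, and the row of [a] then determines [y b]. The weighted sum is
    tracked because for constant weight 1 it is the sum of the solution. *)
Lemma solves_extend S b a w x :
  leaf S b a -> solves (S :\ a :\ b) (fun v => w v - (r a v)%:R * w b) x ->
  exists y, solves S w y /\
    \sum_(v in S) w v * y v = 2 * (w a * w b) +
      \sum_(v in S :\ a :\ b) (w v - (r a v)%:R * w b) * x v.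
Proof.
move=> lf sx; set S' := S :\ a :\ b.
pose xb := w a - \sum_(u in S') (r a u)%:R * x u.
pose y v := if v == a then w b else if v == b then xb else x v.
have ab := leaf_neq lf.
have ya : y a = w b by rewrite /y eqxx.
have yb : y b = xb by rewrite /y eq_sym (negbTE ab) eqxx.
have yS v : v \in S' -> y v = x v.
  by case/in_delete=> _ /negbTE va /negbTE vb; rewrite /y va vb.
have sumy (f : T -> int) :
    \sum_(v in S') f v * y v = \sum_(v in S') f v * x v.
  by apply: eq_bigr => v /yS ->.
exists y; split=> [v vS|].
  rewrite (leaf_sumE _ lf) -/S' ya yb sumy.
  have [->|va] := eqVneq v a.
    by rewrite rirr (rsym a b) (leaf_adj lf) mul0r mul1r add0r subrK.
  have [->|vb] := eqVneq v b.
    rewrite rirr (leaf_adj lf) mul0r mul1r add0r big1 ?addr0 // => u uS.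
    by rewrite (leaf_delete lf uS) mul0r.
  have vS' : v \in S' by rewrite !inE va vb.
  rewrite (rsym v b) (leaf_delete lf vS') mul0r add0r sx //.
  by rewrite (rsym v a) addrC subrK.
rewrite (leaf_sumE _ lf) -/S' ya yb sumy.
have -> : \sum_(v in S') (w v - (r a v)%:R * w b) * x v =
    \sum_(v in S') w v * x v - w b * \sum_(v in S') (r a v)%:R * x v.
  rewrite big_distrr /= -sumrB; apply: eq_bigr => v _; ring.
rewrite /xb; ring.
Qed.

Lemma eq_solves S w w' x :
  {in S, w =1 w'} -> solves S w x -> solves S w' x.
Proof. by move=> ww sx v vS; rewrite -ww // sx. Qed.

Local Close Scope ring_scope.

(** The hub [a] joins [R] with [b] as its pendant vertex. The condition on [d'] keeps [a] away from
    the old pendant vertices, which have [d'] zero. *)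
Lemma pendant_on_extend S b a d d' :
  leaf S b a -> d b = 0 ->
  (forall v, v \in S :\ a :\ b -> d' v = 0 -> d v = 0 /\ r a v = false) ->
  pendant_on (S :\ a :\ b) d' -> pendant_on S d.
Proof.
move=> lf db dd' [R [p Rp]]; have ab := leaf_neq lf.
have ba : (b == a) = false by rewrite eq_sym (negbTE ab).
exists (fun v => if v == a then true else if v == b then false else R v).
exists (fun v => if v == a then b else if v == b then a else p v).
move=> v vS; case: (lf) => aS bS rb.
have [->|va] := eqVneq v a.
  by rewrite ba eqxx.
have [->|vb] := eqVneq v b.
  by rewrite !eqxx; split.
have vS' : v \in S :\ a :\ b by rewrite !inE va vb.
have [pS pp Rpv dv] := Rp v vS'.
have [pvS /negbTE pa /negbTE pb] := in_delete pS.
rewrite pa pb; split=> // /dv[/(dd' v vS')[d0 rav] rv]; split=> // u uS.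
have [->|ua] := eqVneq u a; first by rewrite rsym rav eq_sym pa.
have [->|ub] := eqVneq u b; first by rewrite rsym (leaf_delete lf) // eq_sym pb.
by apply: rv; rewrite !inE ua ub.
Qed.

Lemma leaf_swap S b a : leaf S b a -> deg (S :\ a :\ b) a = 0 -> leaf S a b.
Proof.
move=> lf /eqP; rewrite sum_nat_eq0 => /forall_inP ra0; have ab := leaf_neq lf.
case: (lf) => aS bS rb; split=> // u uS.
have [->|ub] := eqVneq u b; first by rewrite rsym (leaf_adj lf).
have [->|ua] := eqVneq u a; first by rewrite rirr.
by apply/negbTE; rewrite -eqb0; apply: ra0; rewrite !inE ua ub.
Qed.

(* The right-hand side is kept in the form [1 - d]: deleting a leaf [b] with hub
[a] subtracts [wt d b] from the weights of the other neighbours of [a]. *)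
Definition wt d v : int := (1 - (d v)%:Z)%R.

(** Strong induction on [#|S|]. Half of [2 * \sum d + degsum S - #|S|] acts as a budget, at most 3,
    which for [d = 0] is the number of edges beyond [#|S| / 2]. In every case below [j] rises by at
    most what the budget loses. *)
Theorem leaf_elimination S d :
  nonsingular2 S -> ~~ odd #|S| ->
  2 * (\sum_(v in S) d v) + degsum S <= #|S| + 6 ->
  exists x (j : nat), [/\ solves S (wt d) x,
    (\sum_(v in S) wt d v * x v = #|S|%:Z - 2 * j%:Z)%R,
    2 * j + #|S| <= 2 * (\sum_(v in S) d v) + degsum S &
    2 * j + #|S| = 2 * (\sum_(v in S) d v) + degsum S -> pendant_on S d].
Proof.
have [N] := ubnP #|S|; elim: N S d => // N IH S d; rewrite ltnS => leN nS evS bnd.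
have [|S_gt0] := posnP #|S|.
  move/eqP; rewrite cards_eq0 => /eqP->; exists (fun=> 0%R), 0.
  rewrite /degsum !big_set0 cards0; split=> // [v|_]; first by rewrite inE.
  by exists predT, id => v; rewrite inE.
have [a [b lf]] : exists a b, leaf S b a by apply: exists_leaf => //; lia.
have cS := leaf_card lf; have dsE := degsum_delete lf.
have sumd := leaf_sumnE d lf.
have nS' := nonsingular2_delete lf nS; have dS' := nonsingular2_degsum nS'.
set S' := S :\ a :\ b in cS dsE sumd nS' dS' *.
have evS' : ~~ odd #|S'| by move: evS; rewrite cS /= negbK.
have leN' : #|S'| < N by lia.
(* With [wt d a * wt d b = 1 - i] the elimination adds [2 - 2 * i] to the sum: 2 for the two deleted
   vertices, and [j] grows by [i]. *)
have step d' x (j i : nat) :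
    {in S', forall v, wt d' v = wt d v - (r a v)%:R * wt d b}%R ->
    solves S' (wt d') x ->
    (\sum_(v in S') wt d' v * x v = #|S'|%:Z - 2 * j%:Z)%R ->
    (wt d a * wt d b = 1 - i%:Z)%R ->
    exists y, solves S (wt d) y /\
      (\sum_(v in S) wt d v * y v = #|S|%:Z - 2 * (j + i)%:Z)%R.
  move=> ww sx sumx wab.
  have [y [sy sumy]] := solves_extend lf (eq_solves ww sx).
  exists y; split=> //; rewrite sumy wab -/S'.
  rewrite (eq_bigr (fun v => wt d' v * x v)%R) => [|v vS]; last by rewrite ww.
  by rewrite sumx; lia.
have r0 : deg S' a = 0 -> {in S', forall v, r a v = false}.
  move/eqP; rewrite sum_nat_eq0 => /forall_inP ra0 v vS.
  by apply/negbTE; rewrite -eqb0 ra0.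
have [db0|db_gt0] := posnP (d b).
  (* The lost edges from [a] to [S'] are recorded in [d'], so the budget falls by exactly [d a],
     which is also the growth of [j]. *)
  pose d' v := d v + r a v.
  have sumd' : \sum_(v in S') d' v = \sum_(v in S') d v + deg S' a.
    by rewrite big_split.
  have [|x [j [sx sumx jle jeq]]] := IH S' d' leN' nS' evS'; first by lia.
  have [||y [sy sumy]] := step d' x j (d a) _ sx sumx.
  - by move=> v vS; rewrite /wt /d' db0; lia.
  - by rewrite /wt db0; lia.
  exists y, (j + d a); split=> //; first by lia.
  move=> eqj; apply: (pendant_on_extend lf db0 (d' := d')).
    by move=> v vS; rewrite /d'; case: (r a v); lia.
  by apply: jeq; lia.
(* Here [a] and [b] form an isolated edge. The budget gives [d a + d b <= 3], so the natural
   subtraction below does not truncate. Equality forces [d a * d b = 0], hence [d a = 0], and [a]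
   takes the role of the pendant vertex. *)
have [da0|da_gt0] := posnP (deg S' a).
  have [|x [j [sx sumx jle jeq]]] := IH S' d leN' nS' evS'; first by lia.
  have [||y [sy sumy]] := step d x j (d a + d b - d a * d b) _ sx sumx.
  - by move=> v vS; rewrite r0 // mul0r subr0.
  - by rewrite /wt; nia.
  exists y, (j + (d a + d b - d a * d b)); split=> //; first by nia.
  move=> eqj; have da : d a = 0 by nia.
  apply: (pendant_on_extend (leaf_swap lf da0) da (d' := d)).
    move=> v; rewrite !inE => /and3P[va vb vS] dv; split=> //.
    by rewrite (leaf_delete lf) // !inE va vb.
  have -> : S :\ b :\ a = S' by rewrite /S' !setDDl setUC.
  by apply: jeq; nia.
(* Now [wt d b = 0] leaves the other weights unchanged; [j] rises by one while the budget falls by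
   at least two, so equality cannot occur. *)
have [db1|db_neq1] := eqVneq (d b) 1.
  have [|x [j [sx sumx jle jeq]]] := IH S' d leN' nS' evS'; first by lia.
  have [||y [sy sumy]] := step d x j 1 _ sx sumx.
  - by move=> v vS; rewrite {3}/wt db1; lia.
  - by rewrite /wt db1; lia.
  by exists y, (j + 1); split=> //; lia.
(* The only case with a weight exceeding 1: [wt d b = -1] is passed on to the
single remaining neighbour [c] of [a], and [S'] is a perfect matching. *)
have [db2 da0 dega sd0] :
    [/\ d b = 2, d a = 0, deg S' a = 1 & \sum_(v in S') d v = 0] by split; lia.
have [c /setP Nc] : exists c, [set u in S' | r a u] = [set c].
  by apply/cards1P; rewrite -deg_card dega.
have := Nc c; rewrite in_set in_set1 eqxx => /andP[cS' rac].
have rE u : u \in S' -> r a u = (u == c).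
  by move=> uS; have := Nc u; rewrite in_set in_set1 uS.
have dS'E : degsum S' = #|S'| by lia.
have degc : deg S' c = 1.
  have := nonsingular2_deg_gt0 nS' cS'; move: dS'E.
  rewrite /degsum -sum1_card (bigD1 c) //= [RHS](bigD1 c) //=.
  suff : \sum_(i in S' | i != c) 1 <= \sum_(i in S' | i != c) deg S' i by lia.
  by apply: leq_sum => i /andP[iS _]; apply: nonsingular2_deg_gt0.
have [e lf'] := deg1_leaf cS' degc.
have cS2 := leaf_card lf'; have dsE' := degsum_delete lf'.
have nS2 := nonsingular2_delete lf' nS'; have dS2 := nonsingular2_degsum nS2.
have ec := leaf_neq lf'.
set S2 := S' :\ e :\ c in cS2 dsE' nS2 dS2 *.
have e0 : deg S2 e = 0 by lia.
have re0 : {in S2, forall v, r e v = false}.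
  move/eqP: e0; rewrite sum_nat_eq0 => /forall_inP re0 v vS.
  by apply/negbTE; rewrite -eqb0 re0.
have z2 : \sum_(v in S2) 0 = 0 by rewrite big1.
have ev2 : ~~ odd #|S2| by move: evS'; rewrite cS2 /= negbK.
have [||x [j [sx sumx jle _]]] := IH S2 (fun=> 0) _ nS2 ev2; [lia|lia|].
have j0 : j = 0 by lia.
pose w v : int := (wt d v - (r a v)%:R * wt d b)%R.
have d0 v : v \in S' -> d v = 0.
  by move=> vS; move/eqP: sd0; rewrite sum_nat_eq0 => /forall_inP/(_ v vS)/eqP.
have wc : w c = 2%R by rewrite /w /wt rac db2 d0.
have we : w e = 1%R.
  case: (lf') => eS _ _; by rewrite /w /wt rE // (negbTE ec) d0 // mul0r !subr0.
have w2 : {in S2, wt (fun=> 0) =1 fun v => w v - (r e v)%:R * w c}%R.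
  move=> v vS; have [vS' _ vc] := in_delete vS.
  by rewrite re0 // /w /wt rE // (negbTE vc) d0 // !mul0r !subr0.
have [y [sy sumy]] := solves_extend lf' (eq_solves w2 sx).
have [t [st sumt]] := solves_extend lf sy.
(* The two eliminations add [2 * -1] and [2 * 2] to [#|S2| = #|S| - 4], which gives [#|S| - 2] and
   [j = 1]. The budget was 3, so equality cannot occur. *)
exists t, 1; split=> //; try lia.
rewrite sumt -/S' sumy -/S2.
rewrite (eq_bigr (fun v => wt (fun=> 0) v * x v)%R) => [|v vS]; last by rewrite w2.
by rewrite sumx wc we /wt db2 da0; lia.
Qed.

End LeafElimination.

Lemma big_in_setT (R : Type) (idx : R) (op : R -> R -> R) (T : finType)
    (F : T -> R) :
  \big[op/idx]_(i in [set: T]) F i = \big[op/idx]_i F i.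
Proof. by apply: eq_bigl => i; rewrite inE. Qed.

(** * Complements, edge counts, and graphs given by a relation *)

Section Graphs.

Variable T : finType.
Implicit Types (E : {set {set T}}) (u v : T).

Lemma adjC E : symmetric (adj E).
Proof. by move=> u v; rewrite /adj setUC. Qed.

Lemma adj_irr E : simple_graph E -> irreflexive (adj E).
Proof.
move=> /forall_inP sE u; apply/negP => /sE.
by rewrite setUid cards1.
Qed.

Lemma gcompl_simple E : simple_graph (gcompl E).
Proof. by apply/forall_inP => e; rewrite inE => /andP[]. Qed.

Lemma gcomplK E : simple_graph E -> gcompl (gcompl E) = E.
Proof.
move=> /forall_inP sE; apply/setP => e; rewrite !inE negb_and negbK.
by case: (boolP (e \in E)) => [/sE ->|_]; [rewrite orbT | case: (#|e| == 2)].
Qed.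

Lemma card_gcompl E : simple_graph E -> #|E| + #|gcompl E| = 'C(#|T|, 2).
Proof.
move=> /forall_inP sE; rewrite -card_draws.
have -> : gcompl E = [set e : {set T} | #|e| == 2] :\: E.
  by apply/setP => e; rewrite !inE andbC.
rewrite cardsDS; last by apply/subsetP => e /sE; rewrite inE.
apply: subnKC; apply: subset_leq_card.
by apply/subsetP => e /sE; rewrite inE.
Qed.

(** Entrywise form of A(G) + I = J - B; the diagonal is covered because the complement has no
    loops. *)
Lemma mem_closed_nbhd E u v :
  simple_graph E -> (u \in closed_nbhd E v) = ~~ adj (gcompl E) v u.
Proof.
move=> sE; rewrite inE /adj inE cards2 negb_and negbK.
by rewrite eq_sym; case: eqVneq.
Qed.

(** Handshake lemma, by double counting incidences of vertices and edges. *)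
Lemma sum_adj E : simple_graph E -> \sum_u \sum_v adj E u v = 2 * #|E|.
Proof.
move=> sE; have /forall_inP sE2 := sE.
have -> : 2 * #|E| = \sum_(e in E) \sum_u (u \in e).
  rewrite mulnC -sum_nat_const; apply: eq_bigr => e /sE2/eqP <-.
  by rewrite -sum1_card big_mkcond; apply: eq_bigr => u _; case: (u \in e).
rewrite [RHS]exchange_big; apply: eq_bigr => u _.
have -> : \sum_v adj E u v = #|[set v | adj E u v]|.
  rewrite -sum1_card [RHS]big_mkcond; apply: eq_bigr => v _; rewrite inE.
  by case: (adj E u v).
have -> : \sum_(e in E) (u \in e) = #|[set e in E | u \in e]|.
  rewrite -sum1_card [RHS]big_mkcond [LHS]big_mkcond; apply: eq_bigr => e _.
  by rewrite inE; case: (e \in E); case: (u \in e).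
rewrite -(card_in_imset (f := fun v => [set u; v])) => [|v v'].
  apply: eq_card => e; rewrite !inE; apply/imsetP/andP => [[v]|[eE ue]].
    by rewrite inE => ruv ->; rewrite !inE eqxx.
  have /eqP := sE2 e eE; rewrite (cardsD1 u) ue => -[] /eqP/cards1P[v ev].
  by exists v; rewrite ?inE /adj -ev setD1K.
rewrite !inE => uv _ /setP/(_ v); rewrite !inE eqxx orbT.
by case: eqVneq uv => [->|_ _ /esym/eqP //]; rewrite adj_irr.
Qed.

Definition edges_of (r : rel T) : {set {set T}} :=
  [set e : {set T} | [exists u, exists v, (e == [set u; v]) && r u v]].

Lemma adj_edges_of (r : rel T) u v :
  symmetric r -> adj (edges_of r) u v = r u v.
Proof.
move=> rsym; rewrite /adj inE; apply/existsP/idP => [[a /existsP[b]]|ruv].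
  case/andP=> /eqP/setP uvab rab.
  have := uvab u; have := uvab v; have := uvab a; have := uvab b.
  rewrite !inE !eqxx !orbT /= => bE aE vE uE; move: bE aE.
  case/esym/orP: uE => /eqP->; case/esym/orP: vE => /eqP->; rewrite ?orbb //.
  - by move=> /eqP ba; rewrite ba in rab.
  - by rewrite rsym.
  - by move=> _ /eqP ab; rewrite ab in rab.
by exists u; apply/existsP; exists v; rewrite eqxx.
Qed.

Lemma simple_edges_of (r : rel T) : irreflexive r -> simple_graph (edges_of r).
Proof.
move=> rirr; apply/forall_inP => e; rewrite inE.
case/existsP=> u /existsP[v /andP[/eqP-> ruv]]; rewrite cards2.
by case: (eqVneq u v) ruv => // ->; rewrite rirr.
Qed.

End Graphs.

(** * Coronas: adjacency, size, construction and recognition *)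

Section Corona.

Variables (m : nat) (H : {set {set 'I_m}}).
Implicit Types i j : 'I_m.

Lemma adj_corona_ll i j : adj (corona H) (inl i) (inl j) = adj H i j.
Proof.
rewrite /adj inE; have -> : [set inl i; inl j] = (@inl 'I_m 'I_m) @: [set i; j].
  by rewrite imsetU1 imset_set1.
rewrite mem_imset; last exact/imset_inj/inl_inj.
suff /negbTE-> : (@inl 'I_m 'I_m) @: [set i; j] \notin
    [set [set inl u; inr u] | u : 'I_m] by rewrite orbF.
apply/imsetP => -[u _ /setP/(_ (inr u))]; rewrite !inE eqxx orbT.
by case/imsetP.
Qed.

Lemma adj_corona_lr i j : adj (corona H) (inl i) (inr j) = (i == j).
Proof.
rewrite /adj inE; set e := [set _; _].
have /negbTE-> : e \notin [set (@inl 'I_m 'I_m) @: (d : {set 'I_m}) | d in H].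
  apply/imsetP => -[d _ /setP/(_ (inr j))]; rewrite !inE eqxx orbT.
  by move/esym/imsetP => [].
apply/imsetP/eqP => [[u _ /setP eu]|ij]; last by exists j; rewrite // /e ij.
have := eu (inl u); have := eu (inr u); rewrite !inE !eqxx !orbT /=.
by move=> /eqP[<-] /orP[/eqP[<-]|/eqP].
Qed.

Lemma adj_corona_rr i j : adj (corona H) (inr i) (inr j) = false.
Proof.
apply/negP; rewrite /adj inE => /orP[] /imsetP[u _ /setP eu].
  by have := eu (inr i); rewrite !inE eqxx => /esym/imsetP[].
by have := eu (inl u); rewrite !inE eqxx.
Qed.

Lemma adj_corona_rl i j : adj (corona H) (inr i) (inl j) = (i == j).
Proof. by rewrite adjC adj_corona_lr eq_sym. Qed.

Definition adj_coronaE :=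
  (adj_corona_ll, adj_corona_lr, adj_corona_rl, adj_corona_rr).

Lemma sum_pred1_ord i : \sum_j (i == j) = 1.
Proof.
by rewrite (bigD1 i) //= eqxx big1 // => j; rewrite eq_sym => /negbTE->.
Qed.

Lemma sum_adj_corona : simple_graph H ->
  \sum_s \sum_t adj (corona H) s t = 2 * (m + #|H|).
Proof.
move=> sH; rewrite big_sumType /=.
rewrite (eq_bigr (fun i => \sum_j adj H i j + 1)); last first.
  move=> i _; rewrite big_sumType /=.
  rewrite (eq_bigr (fun j => adj H i j : nat)) => [|j _]; last by rewrite adj_coronaE.
  congr (_ + _); rewrite -[RHS](sum_pred1_ord i).
  by apply: eq_bigr => j _; rewrite adj_coronaE.
rewrite [X in _ + X](eq_bigr (fun=> 1)); last first.
  move=> i _; rewrite big_sumType /= [X in _ + X]big1 => [|j _].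
    rewrite addn0 -[RHS](sum_pred1_ord i).
    by apply: eq_bigr => j _; rewrite adj_coronaE.
  by rewrite adj_coronaE.
rewrite big_split /= sum_adj // sum_nat_const card_ord !muln1.
by move: #|H| => h; lia.
Qed.

End Corona.

(** Any [k] pairs serve as the edges of [H], as [m - 1 <= 'C(m, 2)]; the corona is then transported
    along [split]. *)
Lemma exists_pendant m k : k < m ->
  exists F : {set {set 'I_(m + m)}},
    [/\ simple_graph F, pendant F & #|F| = m + k].
Proof.
move=> km; pose D := [set e : {set 'I_m} | #|e| == 2].
have /card_geqP[s [us ss sD]] : k <= #|D|.
  rewrite card_draws card_ord; case: m km {D} => // m' km.
  by rewrite binS bin1; lia.
pose H := [set e in s].
have cH : #|H| = k by rewrite cardsE (card_uniqP us).
have sH : simple_graph H.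
  by apply/forall_inP => e; rewrite inE => /sD; rewrite inE.
pose r (u v : 'I_(m + m)) := adj (corona H) (split u) (split v).
have rsym : symmetric r by move=> u v; rewrite /r adjC.
have rirr : irreflexive r.
  move=> u; rewrite /r; case: (split u) => i; rewrite adj_coronaE //.
  exact: adj_irr.
have sF := simple_edges_of rirr.
have bs : bijective (@split m m) by exists unsplit; [exact: splitK|exact: unsplitK].
exists (edges_of r); split=> //.
  exists m, H; split=> //; exists (@split m m); split=> // u v.
  by rewrite adj_edges_of.
have := sum_adj sF; have := sum_adj_corona sH; rewrite cH.
have bu : {on predT, bijective (@unsplit m m)}.
  by apply: onW_bij; exists split; [exact: unsplitK|exact: splitK].
have -> : \sum_u \sum_v adj (edges_of r) u v = \sum_s \sum_t adj (corona H) s t.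
  rewrite (reindex _ bu); apply: eq_bigr => i _.
  rewrite (reindex _ bu); apply: eq_bigr => j _.
  by rewrite adj_edges_of // /r !unsplitK.
by move=> -> /eqP; rewrite eqn_pmul2l // => /eqP.
Qed.

(** The involution [p] exchanges [R] with its complement, so [R] is half of the vertices. Numbering
    [R] gives [H], and [g] sends pendant vertices to the [p]-images. *)
Lemma pendant_on_pendant (T : finType) (E : {set {set T}}) :
  simple_graph E -> pendant_on (adj E) [set: T] (fun=> 0) -> pendant E.
Proof.
move=> sE [R [p Rp]].
have pp v : p (p v) = v by case: (Rp v (in_setT v)).
have Rpv v : R (p v) = ~~ R v by case: (Rp v (in_setT v)).
have adjp v u : ~~ R v -> adj E v u = (u == p v).
  by move=> Rv; case: (Rp v (in_setT v)) => _ _ _ /(_ Rv)[_ /(_ u (in_setT u))].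
pose A := [set v | R v].
pose ev (i : 'I_#|A|) : T := enum_val i.
have Rev i : R (ev i) by have := enum_valP i; rewrite inE.
pose g (s : 'I_#|A| + 'I_#|A|) : T :=
  match s with inl i => ev i | inr i => p (ev i) end.
have g_inj : injective g.
  move=> [i|i] [j|j] /= => [/enum_val_inj->|gij|gij|] //.
  - by have := Rev i; rewrite gij Rpv Rev.
  - by have := Rev j; rewrite -gij Rpv Rev.
  - by move/(can_inj pp)/enum_val_inj->.
have g_bij : bijective g.
  apply: inj_card_bij => //; rewrite card_sum card_ord -(cardsC A) leq_add2l.
  rewrite -(card_imset _ (can_inj pp)); apply: subset_leq_card.
  by apply/subsetP => u /imsetP[v]; rewrite !inE => Rv ->; rewrite Rpv.
pose r (i j : 'I_#|A|) := adj E (ev i) (ev j).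
have rsym : symmetric r by move=> i j; rewrite /r adjC.
case: (g_bij) => f gK fK; exists #|A|, (edges_of r); split.
  by apply: simple_edges_of => i; apply: adj_irr.
exists f; split; first by exists g.
suff adjg s t : adj E (g s) (g t) = adj (corona (edges_of r)) s t.
  by move=> u v; rewrite -adjg !fK.
case: s t => [i|i] [j|j] /=; rewrite adj_coronaE.
- by rewrite adj_edges_of.
- rewrite adjC adjp ?Rpv ?Rev // pp.
  by apply/eqP/eqP => [/enum_val_inj|->].
- rewrite adjp ?Rpv ?Rev // pp.
  by apply/eqP/eqP => [/enum_val_inj|->].
- rewrite adjp ?Rpv ?Rev // pp; apply/eqP => pij.
  by have := Rev i; rewrite -pij Rpv Rev.
Qed.

(** * Winning on complements of pendant graphs *)

Local Open Scope ring_scope.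

(** In block form B is [[[A_H, I], [I, 0]]], with inverse [[[0, I], [I, -A_H]]] over any ring.
    Winning means B Y = sg + L, where [sg] is the sum of [Y]; applying the inverse leaves one scalar
    equation for [sg], with coefficient n - 2k - 1. *)
Lemma pendant_N_AW (l n k : nat) (E : {set {set 'I_n}}) :
  (1 < l)%N -> simple_graph E -> pendant (gcompl E) ->
  #|gcompl E| = (n./2 + k)%N -> gcdz (n%:Z - 2 * k%:Z - 1) l%:Z = 1 ->
  N_AW l E.
Proof.
move=> l1 sE [m [H [sH [f [f_bij adjf]]]]] cF gcd1 lab.
have nm : n = (m + m)%N.
  by have := bij_eq_card f_bij; rewrite card_sum !card_ord.
case: (f_bij) => g fK gK.
have sum_g (M : nmodType) (F : 'I_n -> M) : \sum_u F u = \sum_s F (g s).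
  by rewrite (reindex g) //; apply: onW_bij; exists f.
have adjg s t : adj (gcompl E) (g s) (g t) = adj (corona H) s t.
  by rewrite adjf !gK.
have cH : #|H| = k.
  have := sum_adj (gcompl_simple E); rewrite (sum_g nat) /=.
  under eq_bigr => s _ do rewrite (sum_g nat) /=.
  under eq_bigr => s _ do under eq_bigr => t _ do rewrite adjg.
  rewrite sum_adj_corona // cF nm addnn doubleK => /eqP.
  by rewrite eqn_pmul2l // eqn_add2l => /eqP.
have [c cP] : exists c : 'Z_l, c * ((m + m)%:R - (2 * k)%:R - 1) = 1.
  have [a [b ab]] := Bezoutz (n%:Z - 2 * k%:Z - 1) l%:Z.
  have zE : n%:Z - 2 * k%:Z - 1 = (m + m)%:Z - (2 * k)%:Z - 1 by lia.
  exists a%:~R; move/(congr1 (fun z : int => z%:~R : 'Z_l)): ab.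
  rewrite gcd1 zE rmorphD !rmorphM /= !rmorphB /= -!pmulrn.
  by rewrite pchar_Zp // mulr0 addr0.
pose h i j : 'Z_l := (adj H i j)%:R.
have sum_h : \sum_i \sum_j h i j = (2 * k)%:R.
  rewrite -cH -sum_adj // natr_sum; apply: eq_bigr => i _.
  by rewrite natr_sum.
pose L s := lab (g s).
pose q := \sum_i (L (inr i) + L (inl i) - \sum_j h i j * L (inr j)).
(* Summing the entries of [Y] gives [sg = (n - 2k) sg + q], which is solved with the inverse [c] of
   n - 2k - 1. *)
pose sg := - (c * q).
pose Y (s : 'I_m + 'I_m) : 'Z_l := match s with
  | inl i => sg + L (inr i)
  | inr i => sg + L (inl i) - \sum_j h i j * (sg + L (inr j))
  end.
have sumY : \sum_s Y s = sg.
  rewrite big_sumType /= -big_split /=.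
  rewrite (eq_bigr (fun i => sg + sg - (\sum_j h i j) * sg +
     (L (inr i) + L (inl i) - \sum_j h i j * L (inr j)))); last first.
    move=> i _; under eq_bigr => j _ do rewrite mulrDr.
    rewrite big_split /= -mulr_suml; ring.
  rewrite big_split /= -/q sumrB -mulr_suml sum_h sumr_const card_ord.
  have qE : q = - sg * ((m + m)%:R - (2 * k)%:R - 1).
    by rewrite /sg opprK mulrAC cP mul1r.
  by rewrite qE natrD -mulr_natl; ring.
have CY s : \sum_t (adj (corona H) s t)%:R * Y t = sg + L s.
  rewrite big_sumType /=; case: s => i.
    rewrite [X in _ + X](bigD1 i) //= adj_coronaE eqxx mul1r.
    rewrite [X in _ + (_ + X)]big1 => [|j]; last first.
      by rewrite adj_coronaE eq_sym => /negbTE->; rewrite mul0r.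
    rewrite addr0 (eq_bigr (fun j => h i j * (sg + L (inr j)))) => [|j _].
      by rewrite addrC subrK.
    by rewrite adj_coronaE.
  rewrite [X in _ + X]big1 => [|j _]; last by rewrite adj_coronaE mul0r.
  rewrite addr0 (bigD1 i) //= adj_coronaE eqxx mul1r big1 ?addr0 // => j.
  by rewrite adj_coronaE eq_sym => /negbTE->; rewrite mul0r.
exists (fun u => nat_of_ord (Y (f u))) => u.
have -> : ((\sum_(v < n | u \in closed_nbhd E v) Y (f v))%N)%:R =
    \sum_s Y s - \sum_t (adj (corona H) (f u) t)%:R * Y t.
  rewrite natr_sum big_mkcond sum_g -sumrB; apply: eq_bigr => s _.
  rewrite mem_closed_nbhd // adjC adjf gK natr_Zp.
  by case: (adj _ _ _); rewrite ?mul1r ?mul0r ?subrr ?subr0.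
by rewrite sumY CY /L fK; ring.
Qed.

(** * What winnability imposes modulo the divisors of [l] *)

(** The argument det = -det says nothing in characteristic 2, so it is run over the integers and
    reduced. *)
Lemma det_alternating_mod2 n (A : 'M['F_2]_n) :
  odd n -> (forall i, A i i = 0) -> (forall i j, A i j = A j i) -> \det A = 0.
Proof.
move=> n_odd A0 Asym.
(* A lift of [A] to a skew-symmetric integer matrix. *)
pose C : 'M[int]_n := \matrix_(i, j)
  if (i < j)%N then (A i j : nat)%:Z else - (A i j : nat)%:Z.
have CT : C^T = -1 *: C.
  apply/matrixP => i j; rewrite !mxE Asym mulN1r.
  by case: ltngtP => [||/val_inj->]; rewrite ?opprK ?A0.
have detC : \det C = 0.
  have := det_tr C; rewrite CT detZ -signr_odd n_odd expr1 mulN1r.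
  by move: (\det C) => x; lia.
have -> : A = map_mx intr C.
  apply/matrixP => i j; rewrite !mxE.
  case: ifP => _; rewrite ?rmorphN /= -pmulrn natr_Zp //.
  by case: (A i j) => -[|[|]] // ?; apply/val_inj.
by rewrite det_map_mx detC rmorph0.
Qed.

(* Testing against the unit labelings turns solvability into injectivity of the
symmetric matrix [A(G) + I = J - A(gcompl E)] modulo every divisor of [l]. *)
Lemma N_AW_injective (l p n : nat) (E : {set {set 'I_n}}) (y : 'I_n -> int) :
  (1 < l)%N -> (p %| l)%N -> simple_graph E -> N_AW l E ->
  (forall u, (p %| \sum_v y v - \sum_v (adj (gcompl E) u v)%:R * y v)%Z) ->
  forall v, (p %| y v)%Z.
Proof.
move=> l1 pl sE aw py v0.
have [t tP] := aw (fun u => - (u == v0)%:R).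
pose z u : int := \sum_v (~~ adj (gcompl E) v u)%:R * (t v)%:Z.
have pz u : (p %| z u - (u == v0)%:R)%Z.
  have -> : z u = (\sum_(v < n | u \in closed_nbhd E v) t v)%:Z.
    rewrite -natz natr_sum big_mkcond; apply: eq_bigr => v _.
    rewrite mem_closed_nbhd //.
    by case: (adj _ _ _); rewrite /= ?mul1r ?mul0r ?natz.
  have /eqP := tP u; rewrite addrC subr_eq0 => /eqP/(congr1 val) /=.
  rewrite !val_Zp_nat // => /eqP tl.
  apply: (@dvdz_trans l); first exact: pl.
  by rewrite [(u == v0)%:R]natz -eqz_mod_dvd !modz_nat eqz_nat.
(* With M = J - B, the vector [z] is M t, congruent to the unit vector at [v0]. Symmetry of M turns
   y^T M t into t^T M y, whose terms are divisible by [p]. *)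
have -> : y v0 = \sum_v (t v)%:Z * (\sum_u y u - \sum_u (adj (gcompl E) v u)%:R * y u)
    - \sum_u y u * (z u - (u == v0)%:R).
  have -> : \sum_u y u * (z u - (u == v0)%:R) = \sum_u y u * z u - y v0.
    under eq_bigr => u _ do rewrite mulrBr.
    rewrite sumrB; congr (_ - _).
    rewrite (bigD1 v0) //= eqxx mulr1 big1 ?addr0 // => u /negbTE->.
    by rewrite mulr0.
  suff -> : \sum_u y u * z u = \sum_v (t v)%:Z *
      (\sum_u y u - \sum_u (adj (gcompl E) v u)%:R * y u) by lia.
  under eq_bigr => u _ do rewrite mulr_sumr.
  rewrite exchange_big; apply: eq_bigr => v _ /=.
  rewrite -sumrB mulr_sumr; apply: eq_bigr => u _.
  by case: (adj _ _ _) => /=; ring.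
apply: rpredB; apply: rpred_sum => u _; first exact/dvdz_mull/py.
exact/dvdz_mull/pz.
Qed.

(** The parity condition says that J - B kills the indicator of [Y] modulo 2. *)
Lemma N_AW_injective2 (l n : nat) (E : {set {set 'I_n}}) (Y : {set 'I_n}) :
  (1 < l)%N -> ~~ odd l -> simple_graph E -> N_AW l E ->
  (forall u, odd (deg (adj (gcompl E)) Y u) = odd #|Y|) -> Y = set0.
Proof.
move=> l1 l_even sE aw Yodd; apply/setP => v; rewrite inE.
have l2 : (2 %| l)%N by rewrite dvdn2.
suff dvd u : (2%:Z %| \sum_v (v \in Y)%:R -
    \sum_v (adj (gcompl E) u v)%:R * (v \in Y)%:R)%Z.
  by have := N_AW_injective l1 l2 sE aw dvd v; case: (v \in Y).
have -> : \sum_v (v \in Y)%:R = #|Y|%:Z.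
  rewrite -sum1_card -natz natr_sum [RHS]big_mkcond.
  by apply: eq_bigr => i _; case: (i \in Y).
have -> : \sum_v (adj (gcompl E) u v)%:R * (v \in Y)%:R =
    (deg (adj (gcompl E)) Y u)%:Z.
  rewrite /deg -natz natr_sum [RHS]big_mkcond.
  by apply: eq_bigr => i _; case: (i \in Y); rewrite ?mulr1 ?mulr0.
by have := Yodd u; lia.
Qed.

(** A nonempty kernel vector [Y] of B has odd size, as otherwise J - B kills it. A kernel vector
    [(c, Z)] of the bordered matrix has [#|Z|] even and B Z = c. If [c = 0], J - B kills [Z], so the
    vector is zero; if [c = 1], J - B kills [W], the sum of [Y] and [Z] over F_2, so [Y = Z] against
    parity. *)
Lemma N_AW_nonsingular2 (l n : nat) (E : {set {set 'I_n}}) :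
  (1 < l)%N -> ~~ odd l -> ~~ odd n -> simple_graph E -> N_AW l E ->
  nonsingular2 (adj (gcompl E)) [set: 'I_n].
Proof.
move=> l1 l_even n_even sE aw Y _ Yev; set F := gcompl E in Yev *.
have inj := N_AW_injective2 l1 l_even sE aw.
apply: contraNeq (n_even) => Y0.
have Yodd : odd #|Y|.
  apply: contraNT Y0 => Yeven; apply/eqP/inj => u.
  by rewrite (negbTE Yeven); apply/negbTE/Yev; rewrite inE.
(* The bordered matrix is alternating of odd order, hence has a kernel vector. *)
pose A : 'M['F_2]_(1 + n) := block_mx 0 (const_mx 1) (const_mx 1)
  (\matrix_(i, j) (adj F i j)%:R).
have /eqP/det0P[w w0 wA] : \det A = 0 :> 'F_2.
  apply: det_alternating_mod2 => [|i|i j]; first by rewrite add1n /= n_even.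
    case: (split_ordP i) => i' ->; rewrite ?block_mxEul ?block_mxEdr mxE //.
    by rewrite adj_irr //; apply: gcompl_simple.
  suff AT : A^T = A by have /matrixP/(_ j i) := AT; rewrite mxE.
  rewrite tr_block_mx trmx0 !trmx_const; congr block_mx.
  by apply/matrixP => i' j'; rewrite !mxE adjC.
pose c := w 0 (lshift n 0); pose y (i : 'I_n) := w 0 (rshift 1 i).
have F2E (x : 'F_2) : x = (x != 0)%:R.
  by case: eqVneq => [->//|]; case: x => -[|[|]] // i _; apply/val_inj.
have F2odd a : a%:R = (odd a)%:R :> 'F_2.
  rewrite -[in LHS](odd_double_half a) natrD -muln2 natrM.
  by rewrite (_ : 2%:R = 0) ?mulr0 ?addr0 //; apply/val_inj.
have F2inj (a b : bool) : a%:R = b%:R :> 'F_2 -> a = b by case: a; case: b.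
have F2N (x : 'F_2) : - x = x by case: x => -[|[|]] // i; apply/val_inj.
pose Z := [set i | y i != 0].
have yE i : y i = (i \in Z)%:R by rewrite inE -F2E.
have wsum (f : 'I_(1 + n) -> 'F_2) : \sum_i f i =
    f (lshift n 0) + \sum_i f (rshift 1 i).
  by rewrite big_split_ord big_ord1.
have sumy : \sum_i y i = 0.
  have /matrixP/(_ 0 (lshift n 0)) := wA.
  rewrite !mxE wsum block_mxEul mxE mulr0 add0r => S0; rewrite -[RHS]S0.
  by apply: eq_bigr => i _; rewrite block_mxEdl mxE mulr1.
have sumFy u : \sum_i (adj F u i)%:R * y i = c.
  have /matrixP/(_ 0 (rshift 1 u)) := wA.
  rewrite !mxE wsum block_mxEur mxE mulr1 -/c => /eqP.
  rewrite addrC addr_eq0 F2N => /eqP S0; rewrite -[RHS]S0.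
  by apply: eq_bigr => i _; rewrite block_mxEdr mxE adjC mulrC.
have Zeven : odd #|Z| = false.
  apply: F2inj; rewrite -F2odd -sum1_card natr_sum big_mkcond /=.
  by apply: etrans sumy; apply: eq_bigr => i _; rewrite yE; case: (i \in Z).
have degZ u : odd (deg (adj F) Z u) = (c != 0).
  apply: F2inj; rewrite -F2odd -F2E /deg natr_sum big_mkcond /= -(sumFy u).
  by apply: eq_bigr => i _; rewrite yE; case: (i \in Z); rewrite ?mulr1 ?mulr0.
have [c0|c0] := eqVneq c 0.
  have Z0 : Z = set0 by apply: inj => u; rewrite degZ c0 eqxx Zeven.
  case/eqP: w0; apply/matrixP => a i; rewrite (ord1 a) mxE.
  case: (split_ordP i) => i' ->; first by rewrite (ord1 i').
  by rewrite -/(y i') yE Z0 inE.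
pose W := [set v | (v \in Y) (+) (v \in Z)].
have oddW (f : 'I_n -> nat) : odd (\sum_(v in W) f v) =
    odd (\sum_(v in Y) f v) (+) odd (\sum_(v in Z) f v).
  rewrite -oddD (big_mkcond (mem W)) (big_mkcond (mem Y)) (big_mkcond (mem Z)).
  rewrite /= -big_split /= !(big_morph odd oddD (erefl _)).
  apply: eq_bigr => v _; rewrite in_set.
  by case: (v \in Y); case: (v \in Z); rewrite /= ?addn0 // addnn odd_double.
have W0 : W = set0.
  apply: inj => u; rewrite -sum1_card !oddW !sum1_card Yodd Zeven.
  by rewrite -/(deg _ Z u) degZ c0 -/(deg _ Y u) (negbTE (Yev u (in_setT u))).
have YZ : Y = Z.
  apply/setP => v; move/setP/(_ v): W0; rewrite in_set in_set0.
  by case: (v \in Y); case: (v \in Z).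
by rewrite YZ Zeven in Yodd.
Qed.

(** Elimination is applied with [d = 0], so the right-hand side is constantly 1; the bound
    [n./2 + 3] on edges is the bound [#|S| + 6] on the degree sum. *)
Lemma N_AW_gcd (l n : nat) (E : {set {set 'I_n}}) :
  (1 < l)%N -> ~~ odd l -> (0 < n)%N -> ~~ odd n -> simple_graph E -> N_AW l E ->
  (#|gcompl E| <= n./2 + 3)%N ->
  exists j : nat, [/\ gcdz (n%:Z - 2 * j%:Z - 1) l%:Z = 1,
    (n./2 + j <= #|gcompl E|)%N &
    #|gcompl E| = (n./2 + j)%N -> pendant (gcompl E)].
Proof.
move=> l1 l_even n_gt0 n_even sE aw; have sF := gcompl_simple E.
have nE : n = (2 * n./2)%N by rewrite mul2n even_halfK.
have nS := N_AW_nonsingular2 l1 l_even n_even sE aw.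
have dsE : degsum (adj (gcompl E)) [set: 'I_n] = (2 * #|gcompl E|)%N.
  rewrite -sum_adj // /degsum big_in_setT; apply: eq_bigr => u _.
  by rewrite /deg big_in_setT.
move=> cF; pose cf := #|gcompl E|; rewrite -/cf in cF dsE *.
have cT : #|[set: 'I_n]| = n by rewrite cardsT card_ord.
have d0 : (\sum_(v in [set: 'I_n]) 0)%N = 0%N by rewrite big1.
have [||x [j [sx sumx jle jeq]]] :=
  leaf_elimination (@adjC _ _) (adj_irr sF) (d := fun=> 0%N) nS.
- by rewrite cT.
- by rewrite d0 dsE cT; lia.
rewrite d0 dsE cT in sumx jle jeq.
have {}sumx : \sum_v x v = n%:Z - 2 * j%:Z.
  rewrite -sumx big_in_setT; apply: eq_bigr => v _.
  by rewrite /wt subr0 mul1r.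
have Bx u : \sum_v (adj (gcompl E) u v)%:R * x v = 1.
  by have := sx u (in_setT u); rewrite big_in_setT.
exists j; split.
(* A prime dividing both n - 2j - 1 and [l] divides (J - B) x, hence every [x v], hence also 1, by
   any single row of B x = 1. *)
- apply/eqP; rewrite /gcdz -[1]/(1%:Z) eqz_nat /=; set g := gcdn _ _.
  have g_gt0 : (0 < g)%N by rewrite gcdn_gt0 (ltnW l1) orbT.
  apply: contraT => g1; have p_prime : prime (pdiv g) by rewrite pdiv_prime; lia.
  have pg := pdiv_dvd g.
  have pl : (pdiv g %| l)%N by apply: dvdn_trans pg (dvdn_gcdr _ _).
  have px := N_AW_injective (y := x) l1 pl sE aw.
  have {}px v : (pdiv g %| x v)%Z.
    apply: px => u; rewrite sumx Bx dvdzE.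
    exact: dvdn_trans pg (dvdn_gcdl _ _).
  have : (1 : int) \in dvdz (pdiv g).
    rewrite -(Bx (Ordinal n_gt0)); apply: rpred_sum => v _.
    exact/dvdz_mull/px.
  by rewrite dvdzE /= dvdn1 => /eqP p1; rewrite p1 in p_prime.
- by lia.
- by move=> cfE; apply: pendant_on_pendant => //; apply: jeq; lia.
Qed.

Local Close Scope ring_scope.

(** * The maximum number of edges and the graphs attaining it *)

Theorem theorem4p10 (n l k : nat) :
  0 < n -> 0 < l -> ~~ odd n -> ~~ odd l ->
  (* k is the smallest nonnegative integer with gcd(n - 2k - 1, l) = 1 *)
  (intdiv.gcdz (n%:Z - 2 * k%:Z - 1) l%:Z = 1)%R ->
  (forall j : nat, j < k -> (intdiv.gcdz (n%:Z - 2 * j%:Z - 1) l%:Z <> 1)%R) ->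
  k <= 3 ->
  maxAW n l + (n./2 + k) = 'C(n, 2) /\
  (forall E : {set {set 'I_n}},
     @extremal n l E <->
     (simple_graph E /\ pendant (gcompl E) /\ #|gcompl E| = n./2 + k)).
Proof.
move=> n_gt0 l_gt0 n_even l_even gcdk mink k3.
have l1 : 1 < l by case: l l_gt0 l_even {gcdk mink} => [|[|]].
have nE : n = n./2 + n./2 by rewrite addnn even_halfK.
(* For [j = n./2 - 1] the number n - 2j - 1 is 1, coprime to [l]; minimality bounds [k]. *)
have km : k < n./2.
  rewrite ltnNge; apply/negP => mk; case: (mink n./2.-1); first by lia.
  by rewrite (_ : (_ - _ - _)%R = 1%R); [rewrite gcd1z | lia].
have lower (E : {set {set 'I_n}}) : simple_graph E -> N_AW l E ->
    n./2 + k <= #|gcompl E| /\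
    (#|gcompl E| = n./2 + k -> pendant (gcompl E)).
  (* Beyond [n./2 + 3] edges the bound is strict since [k <= 3], and the equality case is
     vacuous. *)
  move=> sE aw; have [cF|cF] := leqP #|gcompl E| (n./2 + 3); last first.
    by split; lia.
  have [j [gcdj jle jP]] := N_AW_gcd l1 l_even n_gt0 n_even sE aw cF.
  have kj : k <= j by rewrite leqNgt; apply/negP => /mink; apply.
  (* From [k <= j] and [n./2 + j <= #|gcompl E|], equality with [n./2 + k] forces [j = k]. *)
  by split=> [|cFE]; [lia | apply: jP; lia].
have card (E : {set {set 'I_n}}) : simple_graph E -> #|E| + #|gcompl E| = 'C(n, 2).
  by move=> sE; rewrite card_gcompl // card_ord.
have maxE : maxAW n l + (n./2 + k) = 'C(n, 2).
  have [F [sF pF cF]] : exists F : {set {set 'I_n}},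
      [/\ simple_graph F, pendant F & #|F| = n./2 + k].
    by have := exists_pendant km; rewrite -nE.
  pose E := gcompl F; have sE : simple_graph E by apply: gcompl_simple.
  have EF : gcompl E = F by apply: gcomplK.
  have aw : N_AW l E by apply: (@pendant_N_AW _ _ k); rewrite ?EF.
  have cE := card E sE; rewrite EF cF in cE.
  rewrite -cE; congr (_ + _); apply/eqP; rewrite eqn_leq; apply/andP; split.
    apply/bigmax_leqP => E' /andP[sE' /boolp.asboolP aw'].
    by have [le_c _] := lower E' sE' aw'; have := card E' sE'; lia.
  by apply: leq_bigmax_cond; rewrite sE; apply/boolp.asboolP.
split=> // E; split=> [[sE [aw cE]]|[sE [pF cF]]].
  have cF : #|gcompl E| = n./2 + k by have := card E sE; lia.
  by have [_ pF] := lower E sE aw; split=> //; split=> //; apply: pF.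
split=> //; split; first exact: (@pendant_N_AW _ _ k).
by have := card E sE; rewrite cF; lia.
Qed.
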